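(* Let $n$ be a positive integer and let $p$ be a prime dividing $n$. Let $\omega_1:=e^{2\pi i/p}$, $\omega_j:=\omega_1^j$ for $0\le j\le p-1$, and $B:=\{1,\omega_1,\ldots,\omega_{p-1}\}^n\subseteq\mathbb{C}^n$. Let $K(n,p)$ be the minimum $k$ for which there exist vectors $v_1,\ldots,v_k\in B$ such that for every $w\in B$ there is an $i\in\{1,\ldots,k\}$ with $v_i\cdot w=0$. Then $K(n,p)\ge n(p-1)$.
   Context: Here $v\cdot w=\sum_{l=1}^n v_l w_l$ denotes the usual (bilinear, non-conjugated) scalar product of $v=(v_1,\dots,v_n)$ and $w=(w_1,\dots,w_n)$. *)

(* Defs.v *)
From HB Require Import structures.
From mathcomp Require Import all_boot all_order all_algebra all_field.
Set Implicit Arguments. Unset Strict Implicit. Unset Printing Implicit Defensive.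
Import Order.TTheory GRing.Theory Num.Theory.
Local Open Scope ring_scope.

Definition powset (p : nat) (w : algC) (x : algC) : Prop :=
  exists j : nat, (j < p)%N /\ x = w ^+ j.

Definition inB (n p : nat) (w : algC) (v : 'rV[algC]_n) : Prop :=
  forall l : 'I_n, powset p w (v 0 l).

Definition dot (n : nat) (v u : 'rV[algC]_n) : algC :=
  \sum_(l < n) v 0 l * u 0 l.

(* Main.v *)
Require Import Defs.
From HB Require Import structures.
From mathcomp Require Import all_boot all_order all_algebra all_field.
From mathcomp Require Import zify.
Set Implicit Arguments. Unset Strict Implicit. Unset Printing Implicit Defensive.
Import Order.TTheory GRing.Theory Num.Theory.
Local Open Scope ring_scope.

(** Identify [B] with the group [G = (Z/p)^n] through exponents. A sum of [n]
    [p]-th roots of unity vanishes only if every root occurs equally often, so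
    [v . x = 0] forces the coordinate sum of [v + x] to be a constant [kappa].
    Hence the [x] of coordinate sum [kappa - s] are covered by the [v_i] of
    coordinate sum [s], and the product [f] over these [d] vectors of the linear
    forms [v_i . x] vanishes exactly on one class of the coordinate sum.
    The Fourier transform of [f] lives on exponents [a] of degree at most [d],
    where the degree is the sum of the representatives in [0, p).
    As [f] vanishes on a class, its transform satisfies a linear relation along
    each coset of the diagonal, so it is nonzero at both [a] and [a + (j,...,j)]
    for some [a] and [j != 0]. Coordinatewise
    [j a_l + (p - j) ((a_l + j) mod p) >= j (p - j)], which gives
    [p d >= n j (p - j) >= n (p - 1)]. Summing over the [p] classes of [v]
    yields the bound. *)

(** Made for character sums: translating the index multiplies such a sum by a character value other
    than 1. *)
Lemma mulr_neq1_eq0 (c x : algC) : c != 1 -> c * x = x -> x = 0.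
Proof.
move=> c1 cx; apply/eqP; have : (c - 1) * x == 0 by rewrite mulrBl mul1r cx subrr.
by rewrite mulf_eq0 subr_eq0 (negPf c1).
Qed.

(** * Characters and the Fourier transform on (Z/p)^n, with p = [q.+2] *)

Section Characters.

Variables (q : nat) (w : algC).
Hypothesis w_prim : q.+2.-primitive_root w.
Notation Z := 'I_q.+2.

Definition zexp (z : Z) : algC := w ^+ z.

Lemma zexpD (a b : Z) : zexp (a + b) = zexp a * zexp b.
Proof. by rewrite /zexp /= (prim_expr_mod w_prim) exprD. Qed.

Lemma zexp_eq1 (a : Z) : (zexp a == 1) = (a == 0).
Proof.
by rewrite /zexp -(prim_order_dvd w_prim) /dvdn modn_small.
Qed.

Lemma sum_zexp_mulr (c : Z) : c != 0 -> \sum_(j : Z) zexp (j * c) = 0.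
Proof.
move=> c0; apply: (@mulr_neq1_eq0 (zexp c)); first by rewrite zexp_eq1.
rewrite [RHS](reindex_inj (addrI 1)) big_distrr /=.
by apply: eq_bigr => j _; rewrite -zexpD mulrDl mul1r.
Qed.

Variable n : nat.
Notation G := {ffun 'I_n -> Z}.

Definition zdot (a b : G) : Z := \sum_l a l * b l.

Definition zsum (a : G) : Z := \sum_l a l.

Definition zbasis (l : 'I_n) : G := [ffun i => (i == l)%:R].

Definition zdiag (j : Z) : G := [ffun=> j].

Definition zdeg (a : G) : nat := (\sum_l (a l : nat))%N.

Lemma zdotC a b : zdot a b = zdot b a.
Proof. by apply: eq_bigr => l _; rewrite mulrC. Qed.

Lemma zdotDl a b c : zdot (a + b) c = zdot a c + zdot b c.
Proof. by rewrite -big_split; apply: eq_bigr => l _; rewrite ffunE mulrDl. Qed.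

Lemma zdotDr a b c : zdot a (b + c) = zdot a b + zdot a c.
Proof. by rewrite !(zdotC a) zdotDl. Qed.

Lemma zdotNl a b : zdot (- a) b = - zdot a b.
Proof. by rewrite -sumrN; apply: eq_bigr => l _; rewrite ffunE mulNr. Qed.

Lemma zdot0 b : zdot 0 b = 0.
Proof. by apply: big1 => l _; rewrite ffunE mul0r. Qed.

Lemma zdot_basis a l : zdot a (zbasis l) = a l.
Proof.
rewrite /zdot (bigD1 l) //= ffunE eqxx mulr1 big1 ?addr0 // => i /negPf il.
by rewrite ffunE il mulr0.
Qed.

Lemma zdot_diag j b : zdot (zdiag j) b = j * zsum b.
Proof. by rewrite /zdot /zsum big_distrr; apply: eq_bigr => l _; rewrite ffunE. Qed.

Lemma zsumD a b : zsum (a + b) = zsum a + zsum b.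
Proof. by rewrite -big_split; apply: eq_bigr => l _; rewrite ffunE. Qed.

Lemma sum_zexp_zdot a : a != 0 -> \sum_b zexp (zdot a b) = 0.
Proof.
move=> a0; have [l al] : exists l, a l != 0.
  apply/existsP; apply: contraR a0; rewrite negb_exists => /forallP a0.
  by apply/eqP/ffunP => l; rewrite ffunE; apply/eqP; rewrite -[_ == _]negbK a0.
apply: (@mulr_neq1_eq0 (zexp (a l))); first by rewrite zexp_eq1.
rewrite [RHS](reindex_inj (addrI (zbasis l))) big_distrr /=.
by apply: eq_bigr => b _; rewrite zdotDr zdot_basis zexpD.
Qed.

Definition fourier (f : G -> algC) (a : G) : algC :=
  \sum_b f b * zexp (- zdot a b).

(** Fourier inversion: pairing the transform with the character values at [b0] gives [f b0] times
    the order of the group. *)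
Lemma fourier_neq0 f b0 : f b0 != 0 -> exists a, fourier f a != 0.
Proof.
move=> fb0; apply/existsP; apply: contraR fb0; rewrite negb_exists => /forallP f0.
have : \sum_a fourier f a * zexp (zdot a b0) = 0.
  by apply: big1 => a _; move: (f0 a); rewrite negbK => /eqP ->; rewrite mul0r.
have -> : \sum_a fourier f a * zexp (zdot a b0) =
          \sum_b f b * \sum_a zexp (zdot (b0 - b) a).
  transitivity (\sum_a \sum_b f b * zexp (zdot (b0 - b) a)).
    apply: eq_bigr => a _; rewrite big_distrl /=; apply: eq_bigr => b _.
    by rewrite zdotDl zdotNl zexpD ![zdot _ a]zdotC -mulrA [zexp (zdot a b0) * _]mulrC.
  by rewrite exchange_big; apply: eq_bigr => b _; rewrite big_distrr.
rewrite (bigD1 b0) //= [X in _ + X]big1 ?addr0; last first.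
  by move=> b bb0; rewrite sum_zexp_zdot ?mulr0 // subr_eq0 eq_sym.
rewrite subrr (eq_bigr (fun=> 1)); last by move=> a _; rewrite zdot0.
rewrite sumr_const => /eqP; rewrite mulf_eq0 pnatr_eq0 => /orP[-> //|].
by rewrite -leqn0 leqNgt; case/negP; apply/card_gt0P; exists 0.
Qed.

(** Summing over [j] first, orthogonality on Z/p kills every [b] outside the class [s], and [f]
    itself kills those inside. *)
Lemma fourier_diag_sum f s a : (forall b, zsum b = s -> f b = 0) ->
  \sum_j fourier f (a + zdiag j) * zexp (j * s) = 0.
Proof.
move=> f0.
transitivity (\sum_b f b * zexp (- zdot a b) * \sum_j zexp (j * (s - zsum b))).
  rewrite (eq_bigr (fun j => \sum_b f b * zexp (- zdot a b) *
      zexp (j * (s - zsum b)))).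
    by rewrite exchange_big; apply: eq_bigr => b _; rewrite big_distrr.
  move=> j _; rewrite big_distrl; apply: eq_bigr => b _ /=.
  rewrite -!mulrA -!zexpD zdotDl zdot_diag opprD mulrBr -!addrA.
  by rewrite [- (j * _) + _]addrC.
apply: big1 => b _; have [/f0 ->|sb] := eqVneq (zsum b) s; first by rewrite !mul0r.
by rewrite sum_zexp_mulr ?mulr0 // subr_eq0 eq_sym.
Qed.

(** * Products of linear forms and the degrees in their Fourier support *)

Definition linform (v b : G) : algC := \sum_l zexp (v l + b l).

Lemma zdeg_sub_basis a l : (zdeg a <= (zdeg (a - zbasis l)%R).+1)%N.
Proof.
rewrite /zdeg (bigD1 l) //= [X in (_ <= X.+1)%N](bigD1 l) //= -addSn.
apply: leq_add; last first.
  apply: eq_leq; apply: eq_bigr => i /negPf il.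
  by rewrite !ffunE il subr0.
(* Written as a successor mod p, [a l] is at most one more than the lowered coordinate; this also
   covers the wrap from 0 to p - 1. *)
have -> : a l = (a - zbasis l) l + 1 by rewrite !ffunE eqxx subrK.
set z := (a - _) l; rewrite /= (leq_trans (leq_mod _ _)) //.
by rewrite modn_small ?addn1 // ltnS.
Qed.

(** A linear form is a combination of coordinate characters, so each factor shifts the transform by
    basis vectors and raises the degree by at most one; the empty product has transform supported at
    0. *)
Lemma fourier_prod_linform (r : seq G) a :
  fourier (fun b => \prod_(v <- r) linform v b) a != 0 -> (zdeg a <= size r)%N.
Proof.
elim: r a => [|v r IHr] a.
  rewrite /fourier; under eq_bigr => b _ do rewrite big_nil mul1r -zdotNl.
  have [->|a0] := eqVneq a 0.
    by move=> _; rewrite /zdeg big1 // => l _; rewrite ffunE.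
  by rewrite sum_zexp_zdot ?oppr_eq0 // eqxx.
set f := fun b => \prod_(v <- r) linform v b in IHr *.
have -> : fourier (fun b => \prod_(v <- v :: r) linform v b) a =
          \sum_l zexp (v l) * fourier f (a - zbasis l).
  rewrite [RHS](eq_bigr (fun l => \sum_b f b * zexp (- zdot a b) * zexp (v l + b l))).
    rewrite exchange_big; apply: eq_bigr => b _; rewrite big_cons -/(f b).
    by rewrite -big_distrr /= [_ * f b]mulrC -!mulrA [linform _ _ * _]mulrC.
  move=> l _; rewrite big_distrr; apply: eq_bigr => b _ /=.
  rewrite zdotDl zdotNl [zdot (zbasis l) b]zdotC zdot_basis opprB addrC.
  by rewrite !zexpD mulrCA -!mulrA; congr (_ * _); rewrite mulrCA.
move=> nz; have [l] : exists l, fourier f (a - zbasis l) != 0.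
  apply/existsP; apply: contraR nz; rewrite negb_exists => /forallP f0.
  by apply/eqP; apply: big1 => l _; move: (f0 l); rewrite negbK => /eqP ->; rewrite mulr0.
by move=> /IHr le_r; apply: leq_trans (zdeg_sub_basis a l) _.
Qed.

Lemma zdeg_diag (a : G) (j : Z) : j != 0 ->
  (n * (j * (q.+2 - j)) <= j * zdeg a + (q.+2 - j) * zdeg (a + zdiag j)%R)%N.
Proof.
move=> j0; rewrite /zdeg !big_distrr -big_split /=.
rewrite -[n in (n * _)%N]card_ord -sum_nat_const; apply: leq_sum => l _.
rewrite !ffunE /=; have := ltn_ord (a l); have := ltn_ord j.
move: (a l : nat) (j : nat) => x y yp xp.
have [xy|xy] := ltnP (x + y) q.+2.
  rewrite modn_small // mulnDr; nia.
(* On wrap-around [x] is at least p - [y], so the first term suffices alone. *)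
by apply: leq_trans (leq_addr _ _); rewrite leq_mul2l; lia.
Qed.

Lemma prod_linform_size (r : seq G) (s : Z) : (0 < n)%N ->
  (forall b, (\prod_(v <- r) linform v b == 0) = (zsum b == s)) ->
  (n * q.+1 <= q.+2 * size r)%N.
Proof.
move=> n0 rs; set f := fun b => \prod_(v <- r) linform v b.
have [b fb] : exists b, f b != 0.
  (* A point of coordinate sum [s + 1], outside the zero class. *)
  pose b0 : G := [ffun i => (i == Ordinal n0)%:R * (s + 1)].
  exists b0; rewrite rs /zsum (bigD1 (Ordinal n0)) //= ffunE eqxx mul1r.
  rewrite big1 => [|i /negPf il]; last by rewrite ffunE il mul0r.
  by rewrite addr0 -subr_eq0 addrC addKr.
have [a fa] := fourier_neq0 fb.
have f0 c : zsum c = s -> f c = 0 by move=> /eqP; rewrite -rs => /eqP.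
(* Isolating [j = 0] in the diagonal relation forces another nonzero term. *)
have := fourier_diag_sum a f0; rewrite (bigD1 0) //=.
have -> : zdiag 0 = 0 by apply/ffunP => l; rewrite !ffunE.
rewrite addr0 mul0r mulr1 => /eqP; rewrite addr_eq0 => /eqP fa_eq.
have [j /andP[j0 fj]] : exists j, (j != 0) && (fourier f (a + zdiag j) != 0).
  apply/existsP; apply: contraR fa; rewrite negb_exists fa_eq => /forallP fz.
  rewrite oppr_eq0; apply/eqP; apply: big1 => j j0; move: (fz j).
  by rewrite j0 negbK => /eqP ->; rewrite mul0r.
have := zdeg_diag a j0; have := fourier_prod_linform fa.
have := fourier_prod_linform fj; have := ltn_ord j.
have : (0 < j)%N by rewrite lt0n.
move: (zdeg _) (zdeg _) (j : nat) (size r) => d' d i m i0 ip d'm dm nd.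
have : (n * q.+1 <= n * (i * (q.+2 - i)))%N by rewrite leq_mul2l; nia.
by nia.
Qed.

End Characters.

(** * Vanishing sums of p-th roots of unity *)

Lemma prime_root_minimal_size (p : nat) (w : algC) (P : {poly rat}) :
  prime p -> p.-primitive_root w -> root (map_poly ratr P) w ->
  (size P < p)%N -> P = 0.
Proof.
move=> p_pr w_prim Pw szP; apply/eqP; apply: contraTT szP => P0; rewrite -leqNgt.
(* The minimal polynomial of [w] divides [P], and it is the cyclotomic polynomial of degree p -
   1. *)
have [m [Dm _ dv]] := minCpolyP w.
have : (size m <= size P)%N by apply: dvdp_leq => //; rewrite -dv.
suff -> : size m = p by [].
have := minCpoly_cyclotomic w_prim; rewrite Dm => /(congr1 (size \o val)) /=.
rewrite size_map_poly size_cyclotomic totient_prime // prednK //.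
exact: prime_gt0.
Qed.

Lemma zsum_of_vanishing_sum (q n : nat) (w : algC) : prime q.+2 ->
  q.+2.-primitive_root w -> forall c : {ffun 'I_n -> 'I_q.+2},
  \sum_l w ^+ c l = 0 ->
  zsum c = (\sum_(t : 'I_q.+2) t) *+ (n %/ q.+2).
Proof.
move=> p_pr w_prim c c0.
pose N (t : 'I_q.+2) := #|[set l | c l == t]|.
have byfib (R : zmodType) (F : 'I_q.+2 -> R) : \sum_l F (c l) = \sum_t F t *+ N t.
  rewrite (partition_big c xpredT) //=; apply: eq_bigr => t _.
  rewrite (eq_bigr (fun=> F t)) => [|l /eqP -> //].
  by rewrite sumr_const; congr (_ *+ _); apply: eq_card => l; rewrite !inE.
have Nmax t : N t = N ord_max.
  (* Subtracting the multiplicity of the top exponent from all of them keeps the value at [w], since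
     all the roots sum to 0, and removes the term of degree p - 1. *)
  pose P : {poly rat} := \poly_(i < q.+1) ((N (inord i))%:R - (N ord_max)%:R).
  have P0 : P = 0.
    apply: (prime_root_minimal_size p_pr w_prim); last by rewrite ltnS size_poly.
    have w1 : \sum_(t : 'I_q.+2) w ^+ t = 0.
      have := @sum_zexp_mulr q w w_prim 1 (oner_neq0 _).
      by under eq_bigr => i _ do rewrite mulr1.
    rewrite /root (@horner_coef_wide _ q.+2); last first.
      by rewrite size_map_poly (leq_trans (size_poly _ _)).
    have : \sum_(t : 'I_q.+2) (w ^+ t *+ N t - w ^+ t *+ N ord_max) = 0.
      rewrite big_split /= sumrN sumrMnl w1 mul0rn subr0.
      by rewrite -(byfib _ (fun t : 'I_q.+2 => w ^+ t)).
    move=> E; rewrite -[X in _ == X]E; apply/eqP; apply: eq_bigr => i _.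
    rewrite coef_map coef_poly; case: ltnP => iq.
      by rewrite inord_val raddfB /= !ratr_nat mulrBl !mulr_natl.
    have -> : i = ord_max by apply/val_inj/eqP; rewrite eqn_leq iq -ltnS ltn_ord.
    by rewrite raddf0 mul0r subrr.
  have [tq|tq] := ltnP t q.+1.
    move/polyP/(_ t): P0; rewrite coef_poly tq coef0 inord_val => /eqP.
    by rewrite subr_eq0 eqr_nat => /eqP.
  by congr N; apply/val_inj/eqP; rewrite eqn_leq tq -ltnS ltn_ord.
have -> : (n %/ q.+2)%N = N ord_max.
  have := byfib int (fun=> 1); rewrite sumr_const card_ord.
  rewrite (eq_bigr (fun=> 1 *+ N ord_max)) => [|t _]; last by rewrite Nmax.
  rewrite sumr_const card_ord -mulrnA => /eqP; rewrite eqr_nat => /eqP ->.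
  by rewrite mulnK.
by rewrite /zsum (byfib _ id) -sumrMnl; apply: eq_bigr => t _; rewrite Nmax.
Qed.

Theorem theorem1 (n p : nat) (w : algC) :
  (0 < n)%N -> prime p -> (p %| n)%N -> p.-primitive_root w ->
  forall (k : nat) (v : 'I_k -> 'rV[algC]_n),
    (forall i, inB p w (v i)) ->
    (forall x : 'rV[algC]_n, inB p w x -> exists i : 'I_k, dot (v i) x = 0) ->
    (n * (p - 1) <= k)%N.
Proof.
case: p => [|[|q]] // n0 p_pr _ w_prim k v vB cov; rewrite subn1 /=.
(* Exponent vector of [v i]; the default 0 never occurs, as [v i] lies in B. *)
pose A i : {ffun 'I_n -> 'I_q.+2} :=
  [ffun l => odflt 0 [pick j : 'I_q.+2 | v i 0 l == w ^+ j]].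
have vA i l : v i 0 l = w ^+ A i l.
  rewrite ffunE; case: pickP => [j /eqP //|no].
  have [j [jp vj]] := vB i l; have := no (Ordinal jp).
  by rewrite /= vj eqxx.
set kappa := (\sum_(t : 'I_q.+2) t) *+ (n %/ q.+2).
have lin0 (a b : {ffun 'I_n -> 'I_q.+2}) : linform w a b = 0 -> zsum a + zsum b = kappa.
  move=> ab0; rewrite -zsumD; apply: (zsum_of_vanishing_sum p_pr w_prim).
  by rewrite -[RHS]ab0; apply: eq_bigr => l _; rewrite ffunE.
pose r s := [seq A i | i <- enum 'I_k & zsum (A i) == s].
have rk s : (n * q.+1 <= q.+2 * size (r s))%N.
  apply: (prod_linform_size w_prim (s := kappa - s)) => // b.
  rewrite prodf_seq_eq0; apply/hasP/eqP => [[a] /mapP[i]|bs].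
    rewrite mem_filter => /andP[/eqP ais _] -> /= /eqP /lin0.
    by rewrite ais => <-; rewrite addrC addKr.
  (* Some [v i] is orthogonal to the vector with exponents [b]; the sum [kappa] then puts [A i] in
     the class [s]. *)
  have [|i dot0] := cov (\row_l w ^+ b l).
    by move=> l; exists (b l); rewrite mxE.
  have lin : linform w (A i) b = 0.
    rewrite -[RHS]dot0; apply: eq_bigr => l _.
    by rewrite vA mxE (zexpD w_prim).
  exists (A i); last by rewrite /= lin.
  apply: map_f; rewrite mem_filter mem_enum andbT.
  by have /eqP := lin0 _ _ lin; rewrite bs addrCA -subr_eq0 addrAC subrr add0r subr_eq0.
have sumr : (\sum_s size (r s) = k)%N.
  rewrite -[RHS]card_ord -sum1_card (partition_big (fun i => zsum (A i)) xpredT) //=.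
  by apply: eq_bigr => s _; rewrite size_map -sum1_size big_filter big_enum_cond.
(* Adding the p class bounds gives p n (p - 1) <= p k, and p cancels. *)
have : (\sum_(s : 'I_q.+2) n * q.+1 <= \sum_(s : 'I_q.+2) q.+2 * size (r s))%N.
  by apply: leq_sum.
by rewrite sum_nat_const card_ord -big_distrr /= sumr leq_mul2l.
Qed.
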